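(* Let $X$ be a real Banach space, $K$ a nonempty compact convex subset of $X$, and $f:K\times K\to\mathbb{R}$ a bifunction with $f\in\mathcal{Q}(K)$. Suppose that (i) $f_q(\cdot,y):K\to\mathbb{R}$ is upper semicontinuous for all $y\in K$, and (ii) $f_q(x,x)=0$ for all $x\in K$. Then $\operatorname{EP}(f,K)$ is nonempty.
   Context: For $h:X\to[-\infty,+\infty]$ and $\lambda\in\mathbb{R}$ let $S_\lambda(h)=\{x\in X:h(x)\le\lambda\}$. The quasiconvex regularization of $h$ is $h_q(x)=\inf\{\lambda\in\mathbb{R}:x\in\mathrm{co}(S_\lambda(h))\}$ (with $\inf\emptyset=+\infty$), where $\mathrm{co}$ is the convex hull. For $f:K\times K\to\mathbb{R}$ and $x\in K$, extend $f(x,\cdot)$ to $X$ by $+\infty$ outside $K$ and put $f_q(x,\cdot)=(f(x,\cdot))_q$, regarded as a function on $K$. $\mathcal{Q}(K)$ is the family of bifunctions $f:K\times K\to\mathbb{R}$ such that $f_q(x,y)\in\mathbb{R}$ for all $x,y\in K$. $\operatorname{EP}(f,K)=\{x\in K:f(x,y)\ge0\text{ for all }y\in K\}$. *)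

(* Defs.v *)
From HB Require Import structures.
From mathcomp Require Import all_boot all_order all_algebra.
From mathcomp Require Import all_classical all_reals all_analysis.

Set Implicit Arguments.
Unset Strict Implicit.
Unset Printing Implicit Defensive.

Import Order.TTheory GRing.Theory Num.Theory.
Import numFieldNormedType.Exports.

Local Open Scope classical_set_scope.
Local Open Scope ring_scope.

Definition convex_hull (R : realType) (X : lmodType R) (A : set X) : set X :=
  smallest (@convex_set R X) A.

Definition sublevel (R : realType) (X : Type) (h : X -> \bar R) (l : R)
  : set X := [set x | (h x <= l%:E)%E].

(* [ereal_inf set0 = +oo]. *)
Definition quasiconvex_reg (R : realType) (X : lmodType R) (h : X -> \bar R)
  : X -> \bar R :=
  fun x => ereal_inf
    [set l%:E | l in [set l : R | convex_hull (sublevel h l) x]].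

(* A bifunction on K * K is represented by a total [f : X -> X -> R] of which
   only the values on K * K are used: [patch] replaces the values of [f x]
   outside K by +oo, and [f_q K f x y] is only considered for x, y in K. *)
Definition f_q (R : realType) (X : lmodType R) (K : set X) (f : X -> X -> R)
  (x : X) : X -> \bar R :=
  quasiconvex_reg (patch (fun=> +oo%E) K (fun y => (f x y)%:E)).

Definition class_Q (R : realType) (X : lmodType R) (K : set X)
  : set (X -> X -> R) :=
  [set f | forall x y, K x -> K y -> f_q K f x y \is a fin_num].

Definition EP (R : realType) (X : Type) (f : X -> X -> R) (K : set X)
  : set X := [set x | K x /\ forall y, K y -> 0 <= f x y].

(* Counterpart of the library's [lower_semicontinuous]. *)
Definition upper_semicontinuous (R : realType) (T : topologicalType)
  (g : T -> \bar R) : Prop :=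
  forall x a, (g x < a%:E)%E ->
    exists2 V, nbhs x V & forall y, V y -> (g y < a%:E)%E.

(* Main.v *)
Require Import Defs.
From HB Require Import structures.
From mathcomp Require Import all_boot all_order all_algebra.
From mathcomp Require Import finmap.
From mathcomp Require Import all_classical all_reals all_analysis.

Set Implicit Arguments.
Unset Strict Implicit.
Unset Printing Implicit Defensive.

Import Order.TTheory GRing.Theory Num.Theory.
Import numFieldNormedType.Exports.

(** Write P x for the set of points y with f_q(x,y) < 0.  A strict sublevel set of
    a quasiconvex regularization is an increasing union of convex hulls, so P x is
    convex; upper semicontinuity makes each set of x such that y is in P x
    relatively open; and f_q(x,x) = 0 says that x is never in P x.  A relation
    with these three properties on a nonempty compact convex set has a maximal
    element, that is, some x in K with no y of K in P x
    ([exists_maximal_element]).  At this x the inequality f_q(x,y) >= 0 holds for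
    all y in K, and f_q <= f ([quasiconvex_reg_le]) turns x into a solution.

    The existence of maximal elements is as strong as Brouwer's theorem.
    If there is no maximal element, compactness gives finitely many
    points y_i of K and a radius delta such that every x in K has an index i for
    which y_i is in P z for all z in K within delta of x.  Such an index colors
    the points of a fine grid on the simplex with vertices the y_i.  A grid point
    b close, for each index i of its support, to some point of color i
    ([exists_almost_colorful_grid_point]) then has every such y_i in P b, so b,
    a convex combination of them, is in P b: a contradiction.

    That grid point comes from a lemma of Scarf in the form given to it by Petri
    and Voorneveld ([exists_colorful_dominant_set]), which replaces Sperner's
    lemma and spares all triangulations.  A finite set carries one linear order
    for each index in I; a set S is dominant when no point exceeds the minimum of
    S in every order.  Dominant sets of #|I| elements play the role of the cells
    of a triangulation: a facet of a cell lies in exactly two cells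
    ([card_completions]), unless it is on the boundary.  The parity argument
    of Sperner then produces a dominant set in which all colors occur. *)

(** * Dominant sets for a family of linear orders *)

Section IndexedOrders.

Import finset.
Local Open Scope nat_scope.
Local Open Scope set_scope.

Variables (I U : finType) (k : I -> U -> nat).
Hypothesis k_inj : forall i, injective (k i).

Definition dominant (S : {set U}) :=
  [forall y, exists i, [forall x in S, k i y <= k i x]].

Lemma dominantP (S : {set U}) :
  reflect (forall y, exists i, forall x, x \in S -> k i y <= k i x)
          (dominant S).
Proof.
apply: (iffP forallP) => domS y.
  by have /existsP[i /forall_inP Hi] := domS y; exists i.
by have [i Hi] := domS y; apply/existsP; exists i; apply/forall_inP.
Qed.

Lemma dominantS (S S' : {set U}) :
  S \subset S' -> dominant S' -> dominant S.
Proof.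
move=> /fintype.subsetP sSS' /dominantP domS'; apply/dominantP => y.
by have [i Hi] := domS' y; exists i => x /sSS' /Hi.
Qed.

(** A point of S that does not exceed the minimum of S in some order is that
    minimum, so a dominant set consists of its minima.  In particular it has at
    most #|I| elements, and exactly #|I| only if the minima are distinct. *)
Lemma dominant_argmin_onto (S : {set U}) (m : I -> U) :
  dominant S ->
  (forall i, m i \in S) -> (forall i x, x \in S -> k i (m i) <= k i x) ->
  m @: [set: I] = S.
Proof.
move=> /dominantP domS mS m_min; apply/setP => x; apply/imsetP/idP.
  by move=> [i _ ->].
move=> xS; have [i Hi] := domS x; exists i; rewrite ?inE//.
by apply: (@k_inj i); apply/eqP; rewrite eqn_leq Hi ?m_min.
Qed.

(** F has one element less than there are orders, so exactly two orders, i and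
    j, share their minimum.  A point that completes F to a cell
    must become the minimum of one of these two, and stay beyond the
    minima for all the others; dominance forces it to be the largest such point.
    Each of i and j thus contributes exactly one completion.  The last hypothesis
    says that the points eligible for i exist; it is what fails at the
    boundary. *)
Lemma card_completions (F : {set U}) (x0 : U) :
  x0 \in F -> #|F|.+1 = #|I| -> dominant F ->
  (forall i, exists y, forall l, l != i -> exists2 x, x \in F & k l x < k l y) ->
  #|[set x | (x \notin F) && dominant (x |: F)]| = 2.
Proof.
move=> x0F cardF domF Fbnd.
have /fin_all_exists2[m mF m_min] : forall i, exists2 z, z \in F &
    forall x, x \in F -> k i z <= k i x.
  by move=> i; case: (arg_minnP (k i) x0F) => z zF Hz; exists z.
have m_onto := dominant_argmin_onto domF mF m_min.
have [i [j [ij mij]]] : exists i j, i != j /\ m i = m j.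
  have /injectivePn[i [j ij mij]] : ~~ injectiveb m; last by exists i, j.
  apply/injectiveP => m_inj.
  by have := card_imset [set: I] m_inj; rewrite m_onto cardsT -cardF => /n_Sn.
pose M p := [set y | [forall (l | l != p), k l (m l) < k l y]].
have MP p y : reflect (forall l, l != p -> k l (m l) < k l y) (y \in M p).
  by rewrite inE; exact: forall_inP.
have M_lt p y : y \in M p -> k p y <= k p (m p).
  move=> /MP yM; have /dominantP /(_ y) [l Hl] := domF.
  have := Hl _ (mF l); have [->//|lp] := eqVneq l p.
  by rewrite leqNgt yM.
have completion p q : p != q -> m p = m q -> exists x, forall z,
    ((z \notin F) && dominant (z |: F)) && (z \in M p) = (z == x).
  move=> pq mpq.
  have [y0 y0M] : exists y, y \in M p.
    have [y Hy] := Fbnd p; exists y; apply/MP => l /Hy[x xF].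
    by apply: leq_ltn_trans; exact: m_min.
  case: (arg_maxnP (k p) y0M) => x xM x_max.
  exists x => z; apply/idP/eqP => [/andP[/andP[zF /dominantP domz] zM]|->].
    apply: (@k_inj p); apply/eqP; rewrite eqn_leq [X in X && _]x_max //=.
    have [l Hl] := domz x; have [<-|lp] := eqVneq l p.
      by apply: Hl; rewrite !inE eqxx.
    have := Hl (m l); rewrite !inE mF orbT => /(_ isT).
    by have /MP /(_ _ lp) := xM; rewrite ltnNge => /negPf ->.
  have {}xM : x \in M p := xM.
  rewrite xM andbT; apply/andP; split.
    apply/negP => xF; have : x \in m @: [set: I] by rewrite m_onto.
    move=> /imsetP[l _ xl].
    have xp l' : l' != p -> x != m l'.
      by move=> /(MP _ _ xM); apply: contraTneq => ->; rewrite ltnn.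
    have [lp|/xp] := eqVneq l p; last by rewrite xl eqxx.
    by have := xp q; rewrite eq_sym pq => /(_ isT); rewrite xl lp mpq eqxx.
  apply/dominantP => y; have [yM|] := boolP (y \in M p).
    exists p => w; rewrite !inE => /orP[/eqP ->|wF]; first exact: x_max.
    by apply: leq_trans (M_lt _ _ yM) (m_min _ _ wF).
  rewrite inE => /forallPn[l]; rewrite negb_imply -leqNgt => /andP[lp yl].
  exists l => w; rewrite !inE => /orP[/eqP ->|wF].
    by apply/ltnW/(leq_ltn_trans yl); move/MP: xM; exact.
  exact: leq_trans yl (m_min _ _ wF).
have [xi Hxi] := completion i j ij mij.
have [xj Hxj] : exists x, forall z,
    ((z \notin F) && dominant (z |: F)) && (z \in M j) = (z == x).
  by apply: (completion j i); rewrite // eq_sym.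
have := Hxi xi; rewrite eqxx => /andP[xi_ok /MP xiM].
have := Hxj xj; rewrite eqxx => /andP[xj_ok /MP xjM].
have xij : xi != xj.
  apply/eqP => xixj; have /dominantP/(_ xi)[l Hl] := domF.
  have := Hl _ (mF l); rewrite leqNgt => /negP; apply.
  have [li|/xiM//] := eqVneq l i.
  by rewrite xixj; apply: xjM; rewrite li.
have -> : 2 = #|[set xi; xj]| by rewrite cards2 xij.
congr #|pred_of_set _|; apply/setP => z; rewrite !inE.
apply/idP/orP => [z_ok|[/eqP->|/eqP->]//].
suff [p] : exists2 p, p \in [:: i; j] & z \in M p.
  by rewrite mem_seq2 => /orP[]/eqP -> zM; [left|right];
    rewrite -(Hxi, Hxj) z_ok.
have /andP[zF domz] := z_ok.
(* With the point [z] added there are as many minima as orders, so the minima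
   are distinct; hence [z] has destroyed the coincidence between [i] and [j]. *)
have [p zp] : exists p, forall x, x \in F -> k p z <= k p x.
  by have /dominantP/(_ z)[p Hp] := domF; exists p.
pose m' l := if k l z <= k l (m l) then z else m l.
have m'F l : m' l \in z |: F.
  by rewrite /m'; case: ifP; rewrite !inE ?eqxx ?mF ?orbT.
have m'_min l x : x \in z |: F -> k l (m' l) <= k l x.
  rewrite /m' !inE => /orP[/eqP->|xF]; case: (leqP (k l z)) => zl.
  - exact: leqnn.
  - exact: ltnW.
  - exact: leq_trans zl (m_min _ _ xF).
  - exact: m_min.
have /imset_injP m'_inj : #|m' @: [set: I]| == #|[set: I]|.
  by rewrite (dominant_argmin_onto domz m'F m'_min) cardsU1 zF cardsT -cardF.
have m'p : m' p = z by rewrite /m' zp.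
have zM : z \in M p.
  apply/MP => l lp; rewrite ltnNge; apply/negP => zl.
  have m'l : m' l = z by rewrite /m' zl.
  by move/eqP: lp; apply; apply: m'_inj; rewrite ?inE // m'l m'p.
exists p => //; rewrite !inE; apply: contraT; rewrite negb_or => /andP[pi pj].
move/negP: ij; case; apply/eqP; apply: m'_inj; rewrite ?inE //.
have m'E l : p != l -> m' l = m l.
  by rewrite eq_sym => /(MP _ _ zM); rewrite /m' ltnNge => /negPf ->.
by rewrite !m'E.
Qed.

(** * Parity of the number of cells with all colors *)

Variable c : U -> I.

Lemma imsetD1_dup (S : {set U}) x x' :
  x \in S -> x != x' -> c x = c x' -> c @: (S :\ x) \subset c @: (S :\ x').
Proof.
move=> xS xx' cxx'; apply/fintype.subsetP => _ /imsetP[z + ->].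
rewrite !inE => /andP[zx zS].
have [->|zx'] := eqVneq z x'; last by apply: imset_f; rewrite !inE zx'.
by rewrite -cxx'; apply: imset_f; rewrite !inE xx'.
Qed.

(** If removing x leaves each color other than i0 exactly once and the cell is
    not fully colored, then x repeats the color of exactly one x'; removing x'
    instead is the only other way to obtain such a facet. *)
Lemma even_card_colored_facets (S : {set U}) i0 :
  #|S| = #|I| -> c @: S != [set: I] ->
  ~~ odd #|[set x in S | c @: (S :\ x) == [set~ i0]]|.
Proof.
move=> cardS cS; set P := [set x in S | _].
have [->|[x xP]] := set_0Vmem P; first by rewrite cards0.
have P_inj z : z \in P -> {in S :\ z &, injective c}.
  rewrite inE => /andP[zS /eqP cz]; apply/imset_injP; rewrite cz cardsC1.
  by rewrite -cardS (cardsD1 z S) zS.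
have [xS /eqP cx] : x \in S /\ c @: (S :\ x) == [set~ i0].
  by apply/andP; move: xP; rewrite inE.
have cx_i0 : c x != i0.
  apply: contra cS => /eqP cxi0; rewrite -(finset.setD1K xS) imsetU1 cx cxi0.
  by rewrite finset.setUCr.
have : c x \in c @: (S :\ x) by rewrite cx !inE.
move=> /imsetP[x']; rewrite !inE => /andP[x'x x'S] cxx'.
suff -> : P = [set x; x'] by rewrite cards2 eq_sym x'x.
apply/setP => z; rewrite [RHS]inE !finset.in_set1.
apply/idP/orP => [zP|[]/eqP-> //].
  have [_|xz] := eqVneq z x; first by left.
  have [_|x'z] := eqVneq z x'; first by right.
  have := P_inj z zP x x'; rewrite !inE (eq_sym x) xz (eq_sym x') x'z.
  by move=> /(_ xS x'S cxx') xx'; rewrite xx' eqxx in x'x.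
rewrite inE x'S -cx finset.eqEsubset !imsetD1_dup //.
by rewrite eq_sym.
Qed.

(** Both sides count the pairs of a cell and a facet of it that carries exactly
    the colors other than i0. *)
Lemma sum_facets_rooms i0 :
  \sum_(S : {set U} | (#|S| == #|I|) && dominant S)
    #|[set x in S | c @: (S :\ x) == [set~ i0]]| =
  \sum_(F : {set U} | (#|F|.+1 == #|I|) && (c @: F == [set~ i0]))
    #|[set x | (x \notin F) && dominant (x |: F)]|.
Proof.
under eq_bigr do rewrite -sum1_card.
under [RHS]eq_bigr do rewrite -sum1_card.
rewrite (exchange_big_dep xpredT) //= [RHS](exchange_big_dep xpredT) //=.
apply: eq_bigr => x _.
rewrite (reindex_onto (fun F : {set U} => x |: F) (fun S => S :\ x)) /=;
  last first.
  by move=> S; rewrite inE => /andP[_ /andP[xS _]]; rewrite finset.setD1K.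
apply: eq_bigl => F; rewrite !inE eqxx /=.
have [xF|xF] /= := boolP (x \in F).
  rewrite andbF; apply/negbTE; rewrite negb_and; apply/orP; right.
  by apply/eqP => /setP/(_ x); rewrite !inE eqxx xF.
rewrite setU1K // eqxx andbT cardsU1 xF add1n.
by rewrite -!andbA; congr (_ && _); rewrite andbC.
Qed.

(** Counting by facets gives an odd number of pairs, since only the boundary
    facet F0 contributes an odd number; so some cell has an odd number of facets
    with the colors other than i0, and that cell is fully colored. *)
Lemma exists_colorful_room i0 (F0 : {set U}) :
  #|F0|.+1 = #|I| -> c @: F0 = [set~ i0] ->
  #|[set x | (x \notin F0) && dominant (x |: F0)]| = 1 ->
  (forall F : {set U}, #|F|.+1 = #|I| -> c @: F = [set~ i0] -> F != F0 ->
    ~~ odd #|[set x | (x \notin F) && dominant (x |: F)]|) ->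
  exists S : {set U}, [/\ #|S| = #|I|, dominant S & c @: S = [set: I]].
Proof.
move=> cardF0 cF0 outer inner.
have [/existsP[S /and3P[/eqP ? ? /eqP ?]]|/existsPn noroom] := boolP
  [exists S : {set U}, [&& #|S| == #|I|, dominant S & c @: S == [set: I]]].
  by exists S.
have odd_sum (J : finType) (Q : pred J) (E : J -> nat) :
    (forall j, Q j -> ~~ odd (E j)) -> ~~ odd (\sum_(j | Q j) E j).
  move=> HE; elim/big_ind: _ => // a b /negbTE oa /negbTE ob.
  by rewrite oddD oa ob.
have := sum_facets_rooms i0; rewrite [RHS](bigD1 F0) /=; last first.
  by rewrite cardF0 cF0 !eqxx.
move=> /(congr1 odd); rewrite outer oddD /=.
rewrite (negbTE (odd_sum _ _ _ _)); last first.
  move=> S /andP[cardS domS]; apply: even_card_colored_facets.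
    exact/eqP.
  by have := noroom S; rewrite cardS domS.
rewrite (negbTE (odd_sum _ _ _ _)) // => F /andP[/andP[/eqP ? /eqP ?] ?].
exact: inner.
Qed.

End IndexedOrders.

Section ColorfulDominantSet.

Import finset.
Local Open Scope nat_scope.
Local Open Scope set_scope.

Variables (I T : finType) (k : I -> T -> nat) (c : T -> I).
Hypothesis k_inj : forall i, injective (k i).

(** The points of T receive one extra point for each index, which plays the role
    of a vertex of the simplex: the extra point j is the least element for the
    order j and lies beyond T for all the other orders.  A cell that contains the
    extra point j makes the order j useless for dominance over T, so that
    the elements of a cell in T are dominant for the remaining orders. *)
Definition ext_order (i : I) (u : T + I) : nat :=
  match u with
  | inl x => (k i x).+1
  | inr j => if j == i then 0 else (\max_x k i x).+2 + enum_rank j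
  end.

Definition ext_color (u : T + I) : I :=
  match u with inl x => c x | inr j => j end.

Lemma ext_order_inl_inr i j x :
  j != i -> ext_order i (inl x) < ext_order i (inr j).
Proof.
move=> /negbTE /= ->; rewrite !addSn !ltnS; apply: leq_trans (leq_addr _ _).
exact: (leq_bigmax x).
Qed.

Lemma ext_order_inj i : injective (ext_order i).
Proof.
have neq x j : ext_order i (inl x) <> ext_order i (inr j).
  have [->|ji] := eqVneq j i; first by rewrite /= eqxx.
  by move=> E; have := ext_order_inl_inr x ji; rewrite E ltnn.
case=> [x|j] [y|l].
- by move=> [/k_inj ->].
- by move/neq.
- by move/esym/neq.
rewrite /=; case: eqVneq => [->|ji]; case: eqVneq => [->|li] //.
by move/addnI/val_inj/enum_rank_inj ->.
Qed.

(** The only boundary facet with the colors other than i0 consists of the extra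
    points other than i0; its completion is the maximum of T for the order i0.
    Every other facet with these colors meets T, and then the extra point i is
    beyond its minima in all orders but i, as [card_completions] requires.  In a
    fully colored cell, an order useful for dominance over T belongs to an
    extra point outside the cell, so its color comes from a point of T. *)
Theorem exists_colorful_dominant_set (x0 : T) :
  exists S : {set T}, forall y : T, exists2 i, i \in c @: S &
    forall x, x \in S -> k i y <= k i x.
Proof.
pose i0 := c x0; pose F0 : {set T + I} := inr @: [set~ i0].
have cardF0 : #|F0|.+1 = #|I|.
  rewrite card_imset; last by move=> ? ? [].
  by rewrite cardsC1 prednK //; apply/card_gt0P; exists i0.
have cF0 : ext_color @: F0 = [set~ i0].
  by rewrite -imset_comp imset_id.
have outer : #|[set u | (u \notin F0) && dominant ext_order (u |: F0)]| = 1.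
  have [z _ z_max] := @arg_maxnP _ x0 xpredT (k i0) isT.
  suff -> : [set u | (u \notin F0) && dominant ext_order (u |: F0)]
            = [set inl z] by rewrite cards1.
  apply/setP => u; rewrite !inE; apply/andP/eqP => [[uF0 /dominantP domu]|->].
    have [l Hl] := domu (inl z).
    have li0 : l = i0.
      apply/eqP; apply: contraT => li0.
      have /Hl : inr l \in u |: F0.
        by rewrite !inE; apply/orP; right; apply: imset_f; rewrite !inE.
      by rewrite /= eqxx.
    have := Hl u; rewrite !inE eqxx => /(_ isT); rewrite {}li0.
    case: u uF0 {domu Hl} => [w _|j].
      by rewrite /= ltnS => zw; congr inl; apply: (@k_inj i0); apply/eqP;
        rewrite eqn_leq zw andbT; exact: z_max.
    have [-> _|ji0] := eqVneq j i0; first by rewrite /= eqxx.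
    by rewrite /F0 imset_f // !inE.
  split; first by apply/imsetP => -[].
  apply/dominantP => -[x|l]; last first.
    by exists l => v _; rewrite /= eqxx.
  exists i0 => v; rewrite !inE => /orP[/eqP->|/imsetP[j + ->]].
    by rewrite /= ltnS; exact: z_max.
  by rewrite !inE => ji0; apply/ltnW/ext_order_inl_inr.
have [F cardF cF FF0|S [_ /dominantP domS cS]] :=
    exists_colorful_room cardF0 cF0 outer.
  have [x xF] : exists x, inl x \in F.
    apply/existsP; apply: contraT => /existsPn noT; case/eqP: FF0.
    have Finr j : (inr j \in F) = (j != i0).
      have <- : (j \in [set~ i0]) = (j != i0) by rewrite !inE.
      rewrite -cF; apply/idP/imsetP => [jF|[[x|l] uF /= ->//]].
        by exists (inr j).
      by have := noT x; rewrite uF.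
    apply/setP => -[x|j].
      by rewrite (negbTE (noT x)); apply/esym/imsetP => -[].
    rewrite Finr mem_imset ?inE //; by move=> ? ? [].
  have [domF|ndomF] := boolP (dominant ext_order F).
    rewrite (card_completions ext_order_inj xF) // => i.
    exists (inr i) => l li; exists (inl x) => //.
    by apply: ext_order_inl_inr; rewrite eq_sym.
  rewrite (_ : [set u | _] = finset.set0) ?cards0 //.
  apply/setP => u; rewrite !inE.
  apply/negbTE; apply: contra ndomF => /andP[_]; apply: dominantS.
  exact: finset.subsetUr.
exists [set x | inl x \in S] => y; have [i Hi] := domS (inl y).
have ci : i \in ext_color @: S by rewrite cS inE.
exists i; last by move=> x; rewrite inE => /Hi.
case/imsetP: ci => -[x xS ->|j jS ij]; first by apply: imset_f; rewrite inE.
by have := Hi _ jS; rewrite ij /= eqxx.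
Qed.

End ColorfulDominantSet.

(** * Colorings of a grid on the simplex *)

Section GridPoints.

Import finset.
Local Open Scope nat_scope.
Local Open Scope set_scope.

Variables (I : finType) (N : nat).

Definition grid := {a : {ffun I -> 'I_N.+1} | \sum_i a i == N :> nat}.

Definition coord (a : grid) (i : I) : nat := val a i.

Lemma exists_grid_point (b : I -> nat) :
  \sum_i b i = N -> exists a : grid, forall i, coord a i = b i.
Proof.
move=> sumb; have b_lt i : b i < N.+1.
  by rewrite ltnS -sumb (bigD1 i) //= leq_addr.
pose a := [ffun i => Ordinal (b_lt i)].
have sum_a : \sum_i a i == N :> nat.
  by apply/eqP; rewrite -[RHS]sumb; apply: eq_bigr => i _; rewrite ffunE.
by exists (exist _ a sum_a) => i; rewrite /coord /= ffunE.
Qed.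

(** Order the grid by each coordinate, and take a dominant set S with its
    colors C.  The minima over S of the coordinates in C add up to more than
    N - #|I|: otherwise there would be room for a grid point that exceeds all of
    them.  Hence all points of S agree up to #|I| with these minima on C, and
    with zero outside C.  The point b has the minima as coordinates on C,
    increased at one index of C to make the total N. *)
Theorem exists_almost_colorful_grid_point (i0 : I) (c : grid -> I) :
  exists b : grid, forall i, 0 < coord b i -> exists2 a, c a = i &
    forall j, coord a j <= coord b j + #|I| /\ coord b j <= coord a j + #|I|.
Proof.
(* The rank breaks ties between points with the same coordinate. *)
pose k i (a : grid) := coord a i * #|{: grid}| + enum_rank a.
have k_inj i : injective (k i).
  move=> a b; rewrite /k => /(congr1 (modn^~ #|{: grid}|)).
  by rewrite !modnMDl !modn_small ?ltn_ord // => /val_inj/enum_rank_inj.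
have k_le i a b : k i a <= k i b -> coord a i <= coord b i.
  apply: contraTT; rewrite -!ltnNge => ba.
  apply: (@leq_trans ((coord b i).+1 * #|{: grid}|)).
    by rewrite /k mulSnr ltn_add2l ltn_ord.
  by apply: leq_trans (leq_addr _ _); rewrite leq_mul2r ba orbT.
have [a0 _] : exists a : grid, forall i, coord a i = (i == i0) * N.
  apply: exists_grid_point; rewrite (bigD1 i0) //= eqxx mul1n big1 ?addn0 //.
  by move=> i /negbTE ->.
have [S domS] := exists_colorful_dominant_set c k_inj a0.
set C := c @: S in domS.
have [x0 x0S] : exists x0, x0 \in S.
  by have [i /imsetP[x xS _] _] := domS a0; exists x.
have i1C : c x0 \in C by exact: imset_f.
have /fin_all_exists2[m m_le m_att] : forall i, exists2 mi : nat,
    forall x, x \in S -> mi <= coord x i &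
    exists2 x, x \in S & coord x i = mi.
  move=> i; case: (arg_minnP (coord^~ i) x0S) => x xS Hx.
  by exists (coord x i) => //; exists x.
pose mC i := if i \in C then m i else 0.
have mC_le x i : x \in S -> mC i <= coord x i.
  by rewrite /mC; case: ifP => // _; exact: m_le.
have sumS (x : grid) : \sum_i coord x i = N by exact/eqP/(valP x).
have mC_sum : \sum_i mC i <= N.
  by rewrite -(sumS x0); apply: leq_sum => i _; exact: mC_le.
have mC_large : N < \sum_i mC i + #|I|.
  rewrite ltnNge; apply/negP => sum_le.
  have [y yE] : exists y : grid, forall i,
      coord y i = (mC i).+1 + (i == i0) * (N - (\sum_i mC i + #|I|)).
    apply: exists_grid_point; rewrite big_split /=.
    have -> : \sum_i (mC i).+1 = \sum_i mC i + #|I|.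
      by under eq_bigr do rewrite -addn1; rewrite big_split /= sum1_card.
    rewrite [X in _ + X = _](bigD1 i0) //= eqxx mul1n.
    rewrite [X in _ + (_ + X) = _]big1 ?addn0 ?subnKC //.
    by move=> i /negbTE ->.
  have [i iC Hi] := domS y; have [x xS xi] := m_att i.
  by have /k_le := Hi x xS; rewrite yE xi /mC iC addSn ltnNge leq_addr.
have [b bE] : exists b : grid, forall i,
    coord b i = mC i + (i == c x0) * (N - \sum_i mC i).
  apply: exists_grid_point; rewrite big_split /=.
  rewrite [X in _ + X = _](bigD1 (c x0)) //= eqxx mul1n.
  rewrite [X in _ + (_ + X) = _]big1 ?addn0 ?subnKC //.
  by move=> i /negbTE ->.
exists b => i; rewrite bE => bi_gt0.
have : i \in C.
  move: bi_gt0; rewrite /mC; case: ifP => // iC.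
  by have [ix0|_] := eqVneq i (c x0); [rewrite ix0 i1C in iC|].
move=> /imsetP[a aS ->]; exists a => // j; rewrite bE.
have aj := mC_le a j aS.
split; last first.
  apply: leq_add => //; apply: (@leq_trans (N - \sum_i mC i)).
    by case: (_ == _); rewrite ?mul0n ?mul1n.
  by rewrite leq_subLR ltnW.
have rest : \sum_(l | l != j) mC l <= \sum_(l | l != j) coord a l.
  by apply: leq_sum => l _; exact: mC_le.
rewrite -(leq_add2r (\sum_(l | l != j) mC l)).
apply: (@leq_trans (\sum_l coord a l)).
  by rewrite [X in _ <= X](bigD1 j) //= leq_add2l.
rewrite sumS; apply/ltnW/(leq_trans mC_large).
rewrite (bigD1 j) //= -!addnA leq_add2l addnC addnA leq_add2r.
exact: leq_addl.
Qed.

End GridPoints.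

Local Open Scope classical_set_scope.
Local Open Scope ring_scope.

(** * Convexity and quasiconvex regularization *)

Section ConvexCombinations.

Variables (R : realType) (X : lmodType R) (A : set X).
Hypothesis A_convex : @convex_set R X A.

Lemma convex_set_conv (a b : R) (x y : X) :
  0 <= a -> 0 <= b -> a + b = 1 -> A x -> A y -> A (a *: x + b *: y).
Proof.
move=> a_ge0 b_ge0 ab1 Ax Ay.
have a_le1 : a <= 1 by rewrite -ab1 lerDl.
have -> : b = 1 - a by rewrite -ab1 addrAC subrr add0r.
have := A_convex (Itv01 a_ge0 a_le1) (mem_set Ax) (mem_set Ay).
by rewrite inE.
Qed.

(** By induction on the number of terms: a partial sum of total weight s is s
    times a point of A, or zero when s = 0. *)
Lemma convex_set_sum (I : finType) (w : I -> R) (y : I -> X) :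
  (forall i, 0 <= w i) -> \sum_i w i = 1 -> (forall i, 0 < w i -> A (y i)) ->
  A (\sum_i w i *: y i).
Proof.
move=> w_ge0 w_sum Ay.
pose cone (s : R) (v : X) := exists2 z, 0 < s -> A z & v = s *: z.
suff [_ [z Az ->]] : 0 <= \sum_i w i /\ cone (\sum_i w i) (\sum_i w i *: y i).
  by move: Az; rewrite w_sum scale1r; apply.
elim/big_rec2: _ => [|i v s _ [s_ge0 [z Az ->]]].
  by split => //; exists 0; rewrite ?ltxx ?scaler0.
split; first exact: addr_ge0.
have [s0|s_neq0] := eqVneq s 0.
  by exists (y i); rewrite s0 ?scale0r !addr0//; exact: Ay.
have s_gt0 : 0 < s by rewrite lt_neqAle eq_sym s_neq0.
have ws_gt0 : 0 < w i + s by exact: ltr_wpDl.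
have [wi0|wi_neq0] := eqVneq (w i) 0.
  by exists z; rewrite wi0 !add0r ?scale0r ?add0r.
have wi_gt0 : 0 < w i by rewrite lt_neqAle eq_sym wi_neq0 w_ge0.
exists ((w i / (w i + s)) *: y i + (s / (w i + s)) *: z).
  move=> _; apply: convex_set_conv; rewrite ?divr_ge0 ?(ltW ws_gt0) //.
  - by rewrite -mulrDl divff ?gt_eqF.
  - exact: Ay.
  - exact: Az.
by rewrite scalerDr !scalerA ![(w i + s) * _]mulrC !divfK ?gt_eqF.
Qed.

End ConvexCombinations.

Section QuasiconvexRegularization.

Variables (R : realType) (X : lmodType R).
Local Open Scope ereal_scope.

Lemma convex_hull_convex (A : set X) : @convex_set R X (convex_hull A).
Proof.
move=> x y t; rewrite !inE => Ax Ay B [B_convex AB].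
by have := B_convex x y t; rewrite !inE; apply; [apply: Ax|apply: Ay].
Qed.

(** The set is the increasing union of the convex hulls of the sublevel sets of
    h at the levels below l. *)
Lemma convex_quasiconvex_reg_lt (h : X -> \bar R) (l : \bar R) :
  @convex_set R X [set x | quasiconvex_reg h x < l].
Proof.
move=> x y t; rewrite !inE /=.
move=> /ereal_inf_lt[_ [a ax <-] al] /ereal_inf_lt[_ [b bx <-] bl].
have sub c : (c <= Num.max a b)%R ->
    convex_hull (sublevel h c) `<=` convex_hull (sublevel h (Num.max a b)).
  move=> c_le; apply: sub_smallest2r; first exact: convex_hull_convex.
  move=> z; rewrite /sublevel /= => hz.
  by apply: le_trans hz _; rewrite lee_fin.
apply: (@le_lt_trans _ _ (Num.max a b)%:E); last first.
  by rewrite EFin_max gt_max al.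
apply: ereal_inf_lbound; exists (Num.max a b) => //=.
have := @convex_hull_convex (sublevel h (Num.max a b)) x y t.
by rewrite !inE; apply; [apply: (sub a)|apply: (sub b)] => //;
  rewrite le_max lexx ?orbT.
Qed.

Lemma quasiconvex_reg_le (h : X -> \bar R) (x : X) :
  h x \is a fin_num -> quasiconvex_reg h x <= h x.
Proof.
move=> hx; apply: ereal_inf_lbound; exists (fine (h x)); last exact: fineK.
by apply: sub_gen_smallest; rewrite /sublevel /= fineK.
Qed.

End QuasiconvexRegularization.

(** * Maximal elements *)

Section MaximalElements.

Variables (R : realType) (X : normedModType R).

(** Irreflexivity is contradicted at a grid point b: openness of the sets of x
    with y in P x, made uniform by compactness, carries the colors of the nearby
    grid points over to b, and convexity of P b then puts b itself in P b. *)
Theorem exists_maximal_element (K : set X) (P : X -> set X) :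
  K !=set0 -> compact K -> @convex_set R X K ->
  (forall x, K x -> @convex_set R X (P x)) ->
  (forall x y, K x -> K y -> P x y -> \forall z \near x, K z -> P z y) ->
  (forall x, K x -> ~ P x x) ->
  exists2 x, K x & forall y, K y -> ~ P x y.
Proof.
move=> [x0 Kx0] K_compact K_convex P_convex P_open P_irr.
apply: contrapT => noMax.
(* Radii are halved: balls of radius r cover K, while y remains in P z on the
   ball of radius 2r, hence near every point of the small ball. *)
have /choice[Yr Yr_spec] : forall x, exists yr : X * R, K x ->
    [/\ K yr.1, 0 < yr.2 &
      forall z, K z -> `|x - z| < yr.2 + yr.2 -> P z yr.1].
  move=> x; have [Kx|nKx] := pselect (K x); last by exists (x, 0).
  have [y Ky Pxy] : exists2 y, K y & P x y.
    apply: contrapT => noY; apply: noMax; exists x => // y Ky Pxy.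
    by apply: noY; exists y.
  have /nbhs_ballP[e /= e_gt0 He] := P_open x y Kx Ky Pxy.
  exists (y, e / 2) => _; split=> //=; first by rewrite divr_gt0.
  by move=> z Kz; rewrite -splitr => xz; apply: He => //; rewrite -ball_normE.
pose ballr x := ball x (Yr x).2.
have [D DK D_cover] : finite_subset_cover K ballr K.
  move: K_compact; rewrite compact_cover; apply.
    by move=> x Kx; apply: ball_open; have [] := Yr_spec x Kx.
  move=> x Kx; exists x => //; apply: ballxx; by have [] := Yr_spec x Kx.
pose I : finType := fset_sub_type D.
pose y (i : I) := (Yr (val i)).1.
pose r (i : I) := (Yr (val i)).2.
have KD (i : I) : K (val i) by apply/set_mem/DK/valP.
have Ky i : K (y i) by have [] := Yr_spec _ (KD i).
have r_gt0 i : 0 < r i by have [] := Yr_spec _ (KD i).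
have cover_pt x : K x -> exists i : I, `|val i - x| < r i.
  move=> /D_cover[d /= dD]; rewrite /ballr -ball_normE => dx.
  by exists (FSetSub dD).
have [i0 _] := cover_pt x0 Kx0.
pose delta := \big[Order.min/1]_i r i.
have delta_gt0 : 0 < delta by exact: lt_bigmin.
have delta_le i : delta <= r i by exact: bigmin_le.
pose C := \sum_i `|y i|.
have C_ge0 : 0 <= C by exact: sumr_ge0.
pose N := (Num.bound (#|I|%:R * C / delta)).+1.
have N_gt0 : 0 < N%:R :> R by rewrite ltr0n.
(* The colors at b are read off grid points whose coordinates differ by at most
   #|I| / N, hence at distance at most #|I| * C / N. *)
have N_large : #|I|%:R * C / N%:R < delta.
  rewrite ltr_pdivrMr // -ltr_pdivrMl // [X in X < _]mulrC.
  apply: lt_le_trans (archi_boundP _) _.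
    by rewrite divr_ge0 ?mulr_ge0 // ltW.
  by rewrite ler_nat.
pose w (a : grid I N) i : R := (coord a i)%:R / N%:R.
have w_ge0 a i : 0 <= w a i by rewrite divr_ge0.
have w_sum a : \sum_i w a i = 1.
  rewrite -mulr_suml -natr_sum (_ : (\sum_i coord a i)%N = N).
    by rewrite divff ?gt_eqF.
  exact/eqP/(valP a).
pose pt a := \sum_i w a i *: y i.
have Kpt a : K (pt a) by exact: convex_set_sum.
have /choice[c c_spec] : forall a, exists i, `|val i - pt a| < r i.
  by move=> a; exact: cover_pt.
have [b b_spec] := exists_almost_colorful_grid_point i0 c.
apply: (P_irr (pt b)) => //; apply: convex_set_sum => //.
  by apply: P_convex.
move=> i; rewrite /w pmulr_lgt0 ?invr_gt0 // ltr0n => /b_spec[a cai ab].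
have [_ _] := Yr_spec _ (KD i); apply => //.
have -> : val i - pt b = (val i - pt a) + (pt a - pt b).
  by rewrite addrA subrK.
apply: le_lt_trans (ler_normD _ _) _; apply: ltrD.
  by have := c_spec a; rewrite cai.
apply: lt_le_trans (delta_le i); apply: le_lt_trans N_large.
rewrite /pt -sumrB; apply: le_trans (ler_norm_sum _ _ _) _.
rewrite /C mulrAC mulr_sumr; apply: ler_sum => j _.
rewrite -scalerBl normrZ ler_wpM2r // /w -mulrBl normrM.
rewrite [X in _ * X]ger0_norm ?invr_ge0 // ler_wpM2r ?invr_ge0 //.
have [a_le b_le] := ab j.
by rewrite ler_distl lerBlDr -!natrD !ler_nat b_le a_le.
Qed.

End MaximalElements.

Theorem corollary5p1p1 (R : realType) (X : completeNormedModType R)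
  (K : set X) (f : X -> X -> R)
  (K_neq0 : K !=set0)
  (K_compact : compact K)
  (K_convex : @convex_set R X K)
  (f_Q : class_Q K f)
  (f_q_usc : forall y, K y ->
    upper_semicontinuous (fun x : subspace K => f_q K f x y))
  (f_q_diag : forall x, K x -> f_q K f x x = 0%:E) :
  EP f K !=set0.
Proof.
pose P x := [set y | (f_q K f x y < 0)%E].
have [x Kx x_max] : exists2 x, K x & forall y, K y -> ~ P x y.
  apply: exists_maximal_element => //.
  - by move=> x Kx; exact: convex_quasiconvex_reg_lt.
  - move=> x y Kx Ky Pxy; have [V xV VP] := f_q_usc y Ky x 0 Pxy.
    have {}xV : within K (nbhs x) V by rewrite nbhs_subspace_in.
    exact: filterS VP xV.
  - by move=> x Kx; rewrite /P /= f_q_diag // ltxx.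
exists x; split=> // y Ky.
have := x_max y Ky; rewrite /P /= => /negP; rewrite -leNgt => fq_ge0.
rewrite -lee_fin; apply: le_trans fq_ge0 _.
have := @quasiconvex_reg_le R X (patch (fun=> +oo%E) K (fun y => (f x y)%:E)) y.
by rewrite patchT ?inE //; apply.
Qed.
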